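(* For each $N\ge 1$ let $$X_N=\begin{bmatrix} a_N & -b_N^*\\ b_N & C_N\end{bmatrix}\in\mathbb{C}^{(N+1)\times(N+1)},\qquad H_N=\begin{bmatrix}-1&0\\0&I_N\end{bmatrix},$$ where $a_N$ is a real-valued random variable, $b_N$ is a random vector in $\mathbb{C}^N$ and $C_N$ is a random hermitian matrix in $\mathbb{C}^{N\times N}$; let $s\ge0$. Assume: (R0) For each $N>0$ the random variable $a_N$ is independent of the entries of the vector $b_N$ and of the entries of the matrix $C_N$; furthermore $a_N\to0$ in probability as $N\to\infty$. (R1) $b_N=\frac{1}{\sqrt N}[x_{j0}]_{j=1,\dots,N}$, where $(x_{j0})_{j>0}$ are i.i.d. (real or complex) random variables, independent of the entries of $C_N$ for every $N>0$, of zero mean and with $E|x_{j0}|^2=s^2$ for $j>0$. (R2) The random measure $\nu_N=\frac1N\sum_{j=1}^N\delta_{\lambda_j^N}$, where $\lambda_1^N\le\cdots\le\lambda_N^N$ are the eigenvalues of $C_N$, converges as $N\to\infty$ weakly in probability to some non-random measure $\mu_0$ on $\mathbb{R}$. Assume moreover that the random variables $x_{j0}$, $j>0$, are continuous. Let $\zeta_{k_N}^N,\dots,\zeta_N^N$ be the real eigenvalues of $X_N$ appearing in the diagonal part of the canonical form of $(X_N,H_N)$ (see context) and let $$\tau_N=\frac1N\sum_{j=k_N}^N\delta_{\zeta_j^N}.$$ Then $\tau_N$ converges weakly in probability to $\mu_0$ as $N\to\infty$.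
   Context: A matrix $X$ is $H$-selfadjoint if $X^*H=HX$; $X_N$ is $H_N$-selfadjoint. Canonical form: for $H=\operatorname{diag}(-1,1,\dots,1)\in\mathbb{C}^{(n+1)\times(n+1)}$ and an $H$-selfadjoint $X\in\mathbb{C}^{(n+1)\times(n+1)}$ it is known that there exist an invertible $S$ and matrices $X',H'$ with $X=S^{-1}X'S$, $H=S^*H'S$, where $(X',H')$ has one of the following forms, uniquely determined up to permutation of the numbers $\zeta_i$: Case 1. $X'=\begin{bmatrix}\beta&0\\0&\bar\beta\end{bmatrix}\oplus\operatorname{diag}(\zeta_2,\dots,\zeta_n)$, $H'=\begin{bmatrix}0&1\\1&0\end{bmatrix}\oplus I_{n-1}$, with $\operatorname{Im}\beta>0$ and all $\zeta_i\in\mathbb{R}$. Case 2. $X'=[\beta]\oplus\operatorname{diag}(\zeta_1,\dots,\zeta_n)$, $H'=[-1]\oplus I_n$, with $\beta\in\mathbb{R}$ and all $\zeta_i\in\mathbb{R}$. Case 3. $X'=\begin{bmatrix}\beta&1\\0&\beta\end{bmatrix}\oplus\operatorname{diag}(\zeta_2,\dots,\zeta_n)$, $H'=\gamma\begin{bmatrix}0&1\\1&0\end{bmatrix}\oplus I_{n-1}$, with $\beta\in\mathbb{R}$, all $\zeta_i\in\mathbb{R}$, $\gamma\in\{-1,1\}$. Case 4. $X'=\begin{bmatrix}\beta&1&0\\0&\beta&1\\0&0&\beta\end{bmatrix}\oplus\operatorname{diag}(\zeta_3,\dots,\zeta_n)$, $H'=\begin{bmatrix}0&0&1\\0&1&0\\1&0&0\end{bmatrix}\oplus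 I_{n-2}$, with $\beta\in\mathbb{R}$ and all $\zeta_i\in\mathbb{R}$. Applied to $(X_N,H_N)$ (with $n=N$), the numbers $\zeta_i$ are denoted $\zeta^N_{k_N},\dots,\zeta^N_N$, where $k_N=2$ in Cases 1 and 3, $k_N=1$ in Case 2 and $k_N=3$ in Case 4. ($\beta$ is the eigenvalue of nonpositive type, not included in $\tau_N$.) Random measures $\rho_N$ on $\mathbb{R}$ converge weakly in probability to $\mu_0$ if $\int f\,d\rho_N\to\int f\,d\mu_0$ in probability for every bounded continuous $f:\mathbb{R}\to\mathbb{R}$. A random variable is called continuous if its law is absolutely continuous with respect to Lebesgue measure (on $\mathbb{R}$ in the real case, on $\mathbb{C}$ in the complex case). The entries of $C_N$ may be real or complex. *)

(* Defs.v *)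
From HB Require Import structures.
From mathcomp Require Import all_boot all_order all_algebra.
From mathcomp Require Import spectral complex.
From mathcomp Require Import all_classical all_reals all_analysis.
From mathcomp Require Import measurable_realfun.

Set Implicit Arguments.
Unset Strict Implicit.
Unset Printing Implicit Defensive.

Import Order.TTheory GRing.Theory Num.Theory.
Import numFieldNormedType.Exports.

Local Open Scope classical_set_scope.
Local Open Scope ring_scope.
Local Open Scope sesquilinear_scope.
Local Open Scope complex_scope.

(** * Matrices and the canonical form *)

Section Matrices.
Variable R : realType.
Local Notation C := R[i].

Definition Hmx (N : nat) : 'M[C]_(1 + N) := block_mx (- 1%:M) 0 0 1%:M.

Definition Xmx (N : nat) (a : R) (b : 'cV[C]_N) (M : 'M[C]_N) :
  'M[C]_(1 + N) := block_mx (a%:C)%:M (- b ^t*) b M.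

Definition mx_of_rows (k : nat) (rows : seq (seq C)) : 'M[C]_k :=
  \matrix_(i, j) nth 0 (nth [::] rows i) j.

(** The four possible nondiagonal blocks [(B, G)] of a canonical pair, of size
    [k = 2, 1, 2, 3] respectively; [k] is also the index of the first of the
    diagonal entries [zeta_k, ..., zeta_n] which follow the block. *)
Definition canonical_block (k : nat) (B G : 'M[C]_k) : Prop :=
  [\/ k = 2%N /\ (exists2 beta : C, 0 < complex.Im beta &
        B = mx_of_rows k [:: [:: beta; 0]; [:: 0; Num.conj beta]] /\
        G = mx_of_rows k [:: [:: 0; 1]; [:: 1; 0]]),
      k = 1%N /\ (exists beta : R,
        B = mx_of_rows k [:: [:: beta%:C]] /\
        G = mx_of_rows k [:: [:: -1]]),
      k = 2%N /\ (exists beta : R, exists2 gamma : C, gamma = -1 \/ gamma = 1 &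
        B = mx_of_rows k [:: [:: beta%:C; 1]; [:: 0; beta%:C]] /\
        G = gamma *: mx_of_rows k [:: [:: 0; 1]; [:: 1; 0]]) |
      k = 3%N /\ (exists beta : R,
        B = mx_of_rows k [:: [:: beta%:C; 1; 0];
                             [:: 0; beta%:C; 1];
                             [:: 0; 0; beta%:C]] /\
        G = mx_of_rows k [:: [:: 0; 0; 1]; [:: 0; 1; 0]; [:: 1; 0; 0]])].

(** [X = S^-1 X' S] and [H = S^* H' S], where
    [X' = B (+) diag(zeta_k, ..., zeta_(d-1))] and [H' = G (+) I].  The
    entries of the [d x d] matrices are numbered from 0, so that [zeta_j] is
    the entry [(j, j)] of [X']; the values of [zeta] outside of
    [k <= j < d] play no role. *)
Definition has_canonical_form (d : nat) (X H : 'M[C]_d) (k : nat)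
    (zeta : nat -> R) : Prop :=
  exists (m : nat) (e : (k + m)%N = d) (B G : 'M[C]_k) (S : 'M[C]_d),
    let X' := castmx (e, e)
      (block_mx B 0 0 (diag_mx (\row_(j < m) (zeta (k + j)%N)%:C))) in
    let H' := castmx (e, e) (block_mx G 0 0 1%:M) in
    [/\ canonical_block B G, S \in unitmx,
        X = invmx S *m X' *m S & H = S ^t* *m H' *m S].

End Matrices.

(** * Random variables *)

Section Probability.
Context d (T : measurableType d) (R : realType) (P : probability T R).

(** Complex random variables are handled through the identification of the
    complex plane with the measurable space [R * R]. *)
Definition ReIm (z : R[i]) : R * R := (complex.Re z, complex.Im z).

Definition complex_rv (Z : T -> R[i]) : Prop :=
  measurable_fun [set: T] (ReIm \o Z).

(** The sigma-algebra generated by a family of maps. *)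
Definition sigma_gen (I : Type) d' (T' : measurableType d')
    (f : I -> T -> T') : set_system T :=
  <<s \bigcup_i preimage_set_system [set: T] (f i) measurable >>.

Definition sigma_join (E F : set_system T) : set_system T := <<s E `|` F >>.

Definition sigma_rv (Y : T -> R) : set_system T :=
  sigma_gen (fun _ : unit => Y).

Definition sigma_crv (I : Type) (Z : I -> T -> R[i]) : set_system T :=
  sigma_gen (fun i => ReIm \o Z i).

Definition sigma_entries (m n : nat) (M : T -> 'M[R[i]]_(m, n)) :
    set_system T :=
  sigma_crv (fun (ij : 'I_m * 'I_n) t => M t ij.1 ij.2).

Definition indep (E F : set_system T) : Prop :=
  forall A B, E A -> F B -> P (A `&` B) = (P A * P B)%E.

Definition mutual_indep (I : choiceType) (E : I -> set_system T) : Prop :=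
  forall (J : seq I) (A : I -> set T), uniq J ->
    (forall j, j \in J -> E j (A j)) ->
    P (\bigcap_(j in [set` J]) A j) = (\prod_(j <- J) P (A j))%E.

Definition same_law (Y Z : T -> R[i]) : Prop :=
  forall A : set (R * R), measurable A ->
    pushforward P (ReIm \o Y) A = pushforward P (ReIm \o Z) A.

Definition continuous_law (Z : T -> R[i]) : Prop :=
  ((forall t, Z t \is Num.real) /\
    pushforward P (fun t => complex.Re (Z t)) `<< @lebesgue_measure R) \/
  pushforward P (ReIm \o Z) `<<
    (@lebesgue_measure R \x @lebesgue_measure R)%E.

(** [(P^* )%mu] is the outer measure induced by [P]; it agrees with [P] on
    events, see [cvg_in_probaE] below. *)
Definition cvg_in_proba (Y : nat -> T -> R) (l : R) : Prop :=
  forall e : R, 0 < e ->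
    (P^*)%mu [set t | e <= `|Y n t - l|] @[n --> \oo] --> 0%E.

Lemma cvg_in_probaE (Y : nat -> T -> R) (l : R) :
  (forall n, measurable_fun [set: T] (Y n)) ->
  cvg_in_proba Y l <->
  forall e : R, 0 < e -> P [set t | e <= `|Y n t - l|] @[n --> \oo] --> 0%E.
Proof.
move=> mY.
suff E e : (fun n => (P^*)%mu [set t | e <= `|Y n t - l|]) =
           (fun n => P [set t | e <= `|Y n t - l|]).
  by split=> h e e0; [rewrite -E | rewrite E]; exact: h.
apply/funext => n.
apply: measurable_mu_extE.
have mf : measurable_fun [set: T] (fun t => `|Y n t - l|).
  by apply: measurableT_comp => //; exact: measurable_funB.
rewrite [X in measurable X](_ : _ =
    [set: T] `&` (fun t => `|Y n t - l|) @^-1` `[e, +oo[).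
  by apply: mf.
by apply/seteqP; split=> t /=; rewrite in_itv/= andbT => //; case.
Qed.

Definition weak_cvg_in_proba (rho : nat -> T -> {measure set R -> \bar R})
    (mu : {measure set R -> \bar R}) : Prop :=
  forall f : R -> R, continuous f -> bounded_fun f ->
    cvg_in_proba (fun n t => Rintegral (rho n t) [set: R] f)
                 (Rintegral mu [set: R] f).

End Probability.

(** [N^-1 * \sum_(k <= j <= N) delta_(z j)] *)
Definition point_masses (R : realType) (N k : nat) (z : nat -> R) :
    {measure set R -> \bar R} :=
  mscale ((N%:R^-1 : R)%:nng) (msum (fun j => \d_(z (k + j)%N)) (N.+1 - k)).

(* Main.v *)
Require Import Defs.
From HB Require Import structures.
From mathcomp Require Import all_boot all_order all_algebra.
From mathcomp Require Import spectral complex.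
From mathcomp Require Import all_classical all_reals all_analysis.
From mathcomp Require Import measurable_realfun.
From mathcomp Require Import ring lra zify.

Set Implicit Arguments.
Unset Strict Implicit.
Unset Printing Implicit Defensive.

Import Order.TTheory GRing.Theory Num.Theory.
Import numFieldNormedType.Exports.

Local Open Scope classical_set_scope.
Local Open Scope ring_scope.
Local Open Scope sesquilinear_scope.
Local Open Scope complex_scope.

(** The comparison is made pointwise in the sample space: the counting functions
    of the numbers [zeta] and of the eigenvalues of [C] differ by at most 3, so
    that the two empirical measures become indistinguishable for large [N].

    Work with the two hermitian forms [H] and [H X] (the second is hermitian
    because [X] is [H]-selfadjoint).  On the span of the last basis vectors of
    the canonical form, [H] is the identity and [H X] is diagonal with entries
    [zeta_j].  On the hyperplane of vectors with first coordinate 0, [H] is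
    again the standard inner product and [H X] is the form of [C], which the
    spectral theorem makes diagonal with entries [lambda_j].  For real [t], the
    form [H X - t H] is positive definite on the span of the basis vectors with
    [zeta_j > t] and negative semidefinite on the span of the eigenvectors of
    [C] with [lambda_j <= t].  These subspaces intersect trivially, so their
    dimensions add up to at most [N + 1]; the same holds with the two families
    exchanged ([card_pos_neg_diag], [pencil_count]).  As there are at least
    [N - 2] numbers [zeta], the counting functions stay within 3 of each other
    ([canonical_close_counts]).

    It remains to see that families with close counting functions have close
    empirical integrals.  Cut a bounded interval into pieces on which [f]
    oscillates little: on each of them the two sums of [f] differ by a small
    multiple of the number of points, plus a constant independent of [N]
    ([sums_close_on_continuous]).  The points outside of [-K, K] are controlled
    by the empirical measure of the [lambda] alone, integrated against a
    continuous cutoff whose integral for the limit [mu_0] is small; [mu_0] has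
    mass 1 since the constant 1 is a test function ([weak_cvg_mass1],
    [tail_cutoff_small]).  Hence a large deviation of the integral for the
    [zeta] forces a deviation of one of two integrals for the [lambda]
    ([weak_cvg_close_counts]). *)

(** * Intersection of definite subspaces *)

Lemma trmxC_mul (F : numClosedFieldType) m n p (A : 'M[F]_(m, n))
  (B : 'M[F]_(n, p)) : (A *m B) ^t* = B ^t* *m A ^t*.
Proof. by rewrite trmx_mul map_mxM. Qed.

Lemma diag_formE (F : numClosedFieldType) n (d : 'I_n -> F) (u : 'rV[F]_n) :
  (u *m diag_mx (\row_j d j) *m u ^t*) 0 0 = \sum_j d j * `|u 0 j| ^+ 2.
Proof.
rewrite mul_mx_diag mxE; apply: eq_bigr => j _.
by rewrite !mxE normCK mulrCA mulrA.
Qed.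

Lemma rank_rowsub_free (F : fieldType) m n p (f : 'I_p -> 'I_m)
  (A : 'M[F]_(m, n)) : injective f -> row_free A -> \rank (rowsub f A) = p.
Proof.
move=> f_inj freeA; rewrite -[A]mul1mx -mul_rowsub_mx mxrankMfree//.
apply/eqP/row_freeP; exists (rowsub f 1%:M)^T.
apply/matrixP => i j; rewrite mxE (bigD1 (f i))//= !mxE eqxx mul1r.
rewrite big1 ?addr0 ?(inj_eq f_inj) 1?[j == i]eq_sym// => l lfi.
by rewrite !mxE eq_sym (negPf lfi) mul0r.
Qed.

Lemma congr_diag_rowsub (F : numClosedFieldType) m n p (f : 'I_p -> 'I_m)
    (A : 'M[F]_(m, n)) (G : 'M[F]_n) (d : 'I_m -> F) : injective f ->
  A *m G *m A ^t* = diag_mx (\row_j d j) ->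
  rowsub f A *m G *m (rowsub f A) ^t* = diag_mx (\row_j d (f j)).
Proof.
move=> f_inj /matrixP AG; apply/matrixP => i j.
have := AG (f i) (f j); rewrite !mxE (inj_eq f_inj) => <-.
apply: eq_bigr => k _; rewrite !mxE; congr (_ * _).
by apply: eq_bigr => l _; rewrite !mxE.
Qed.

(** The rows of [A] with [d j > 0] span a space on which [G] is positive
    definite, the rows of [B] with [e j <= 0] one on which it is negative
    semidefinite.  A nonzero common vector would contradict both signs, so the
    dimensions add up to at most [n]. *)
Lemma card_pos_neg_diag (R : rcfType) n p q (G : 'M[R[i]]_n)
    (A : 'M[R[i]]_(p, n)) (B : 'M[R[i]]_(q, n)) (d : 'I_p -> R)
    (e : 'I_q -> R) :
  row_free A -> row_free B ->
  A *m G *m A ^t* = diag_mx (\row_j (d j)%:C) ->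
  B *m G *m B ^t* = diag_mx (\row_j (e j)%:C) ->
  (#|[set j | (0 < d j)%R]%SET| + #|[set j | (e j <= 0)%R]%SET| <= n)%N.
Proof.
move=> freeA freeB AG BG; set J := [set j | _]%SET; set I := [set j | _]%SET.
rewrite leqNgt; apply/negP => lt_n.
pose f (j : 'I_#|J|) := enum_val j; pose g (j : 'I_#|I|) := enum_val j.
have finj : injective f by apply: enum_val_inj.
have ginj : injective g by apply: enum_val_inj.
have : (0 < \rank (rowsub f A :&: rowsub g B)%MS)%N.
  have := mxrank_sum_cap (rowsub f A) (rowsub g B).
  rewrite !rank_rowsub_free// => rk.
  have := rank_leq_col (rowsub f A + rowsub g B)%MS; lia.
rewrite lt0n mxrank_eq0 => /rowV0Pn[v].
rewrite sub_capmx => /andP[/submxP[u vu] /submxP[w vw]] v_neq0.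
have : (v *m G *m v ^t*) 0 0 = \sum_j (d (f j))%:C * `|u 0 j| ^+ 2.
  rewrite vu trmxC_mul !mulmxA -(mulmxA u) -(mulmxA u).
  by rewrite (congr_diag_rowsub finj AG) diag_formE.
have -> : (v *m G *m v ^t*) 0 0 = \sum_j (e (g j))%:C * `|w 0 j| ^+ 2.
  rewrite vw trmxC_mul !mulmxA -(mulmxA w) -(mulmxA w).
  by rewrite (congr_diag_rowsub ginj BG) diag_formE.
move=> eq_form.
have dpos j : 0 < (d (f j))%:C :> R[i].
  by rewrite ltcR; have := enum_valP j; rewrite inE.
have le0 : \sum_j (d (f j))%:C * `|u 0 j| ^+ 2 <= 0.
  rewrite -eq_form; apply: sumr_le0 => j _; rewrite mulr_le0_ge0 ?exprn_ge0//.
  by rewrite lecR; have := enum_valP j; rewrite inE.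
have ge0 j : 0 <= (d (f j))%:C * `|u 0 j| ^+ 2.
  by rewrite mulr_ge0 ?exprn_ge0// ltW.
have /eqP := le_anti (introT andP (conj le0 (sumr_ge0 _ (fun j _ => ge0 j)))).
rewrite psumr_eq0// => /allP u0; move/eqP: v_neq0; apply.
rewrite vu [u](_ : _ = 0) ?mul0mx//; apply/rowP => j; rewrite [RHS]mxE.
apply/eqP; have := u0 j (mem_index_enum _).
by rewrite mulf_eq0 gt_eqF//= expf_eq0 normr_eq0.
Qed.

(** * Simultaneous diagonalization of the two forms *)

Lemma char_poly_conj (F : fieldType) n (V D : 'M[F]_n) : V \in unitmx ->
  char_poly (invmx V *m D *m V) = char_poly D.
Proof.
move=> unitV; pose Vp := map_mx polyC V.
have detV : \det Vp != 0.
  by rewrite det_map_mx polyC_eq0 -unitfE -unitmxE.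
(* Both sides times [\det Vp] are determinants of products of matrices. *)
apply: (mulfI detV); rewrite mulrC [RHS]mulrC /char_poly -[RHS]det_mulmx.
rewrite mulrC -det_mulmx /char_poly_mx mulmxBr mulmxBl -!map_mxM.
by rewrite !mulmxA mulmxV// mul1mx scalar_mxC.
Qed.

(** [A] collects the conjugate transposes of the columns of [S^-1] that follow
    the nondiagonal block: these vectors are orthonormal for [H], and
    eigenvectors of [X]. *)
Lemma canonical_form_diag (R : realType) (n k : nat) (X H : 'M[R[i]]_n)
    (zeta : nat -> R) : has_canonical_form X H k zeta ->
  (k <= 3)%N /\ exists (m : nat) (A : 'M[R[i]]_(m, n)),
    [/\ (k + m)%N = n, row_free A, A *m H *m A ^t* = 1%:M &
        A *m (H *m X) *m A ^t* = diag_mx (\row_j (zeta (k + j)%N)%:C)].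
Proof.
move=> [m [e [B [G [S]]]]]; case: n / e X H S => X H S /= [canB unitS -> ->].
split; first by case: canB => -[kE _]; lia.
have unitSt : S ^t* \in unitmx by rewrite map_unitmx unitmx_tr.
pose E : 'M[R[i]]_(m, k + m) := row_mx 0 1%:M.
have ES : E ^t* = col_mx 0 1%:M.
  by rewrite tr_row_mx map_col_mx trmx0 map_mx0 trmx1 map_mx1.
have freeE : row_free E.
  by apply/row_freeP; exists (E ^t*); rewrite ES mul_row_col mulmx1 mul0mx add0r.
exists m, (E *m invmx (S ^t*)); rewrite !castmx_id.
have AS : (E *m invmx (S ^t*)) ^t* = invmx S *m E ^t*.
  by rewrite trmxC_mul trmx_inv map_invmx trmxCK.
split=> //.
- rewrite -row_leq_rank mxrankMfree ?row_leq_rank//.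
  by rewrite row_free_unit unitmx_inv.
- rewrite AS !mulmxA mulmxKV// mulmxK// /E mul_row_block !mul0mx !mul1mx.
  by rewrite !add0r ES mul_row_col mul0mx mul1mx add0r.
- rewrite AS !mulmxA mulmxKV// !mulmxK// /E mul_row_block !mul0mx !mul1mx.
  rewrite !add0r mul_row_block ES mul_row_col.
  by rewrite !(mul0mx, mul1mx, mulmx0, mulmx1, add0r).
Qed.

(** The spectral theorem, with the diagonal entries matched to any given list
    of roots of the characteristic polynomial. *)
Lemma hermitian_diag (R : rcfType) (n : nat) (M : 'M[R[i]]_n) (l : seq R) :
    M \is hermsymmx ->
    char_poly M = \prod_(r <- l) ('X - (r%:C)%:P) ->
  exists (V : 'M[R[i]]_n) (e : 'I_n -> R),
    [/\ V *m V ^t* = 1%:M, V *m M *m V ^t* = diag_mx (\row_j (e j)%:C) &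
        perm_eq [seq e j | j <- enum 'I_n] l].
Proof.
move=> hM charM; have nM := hermitian_normalmx hM.
have /orthomx_spectralP Meq := nM.
have realD := hermitian_spectral_diag_real hM.
set V := spectralmx M in Meq; set D := spectral_diag M in Meq realD.
have unitV : V \in unitmx by apply: spectral_unit.
have Vinv : invmx V = V ^t* by rewrite invmx_unitary// spectral_unitarymx.
have De j : ((complex.Re (D 0 j))%:C : R[i]) = D 0 j.
  have /mxOverP /(_ 0 j) := realD.
  by move=> /complex_realP[r ->].
exists V, (fun j => complex.Re (D 0 j)); split.
- by rewrite -Vinv mulmxV.
- rewrite -Vinv Meq !mulmxA mulmxV// mul1mx -mulmxA mulmxV// mulmx1.
  by congr diag_mx; apply/rowP => j; rewrite mxE De.
have charD : char_poly M = \prod_(j < n) ('X - (D 0 j)%:P).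
  rewrite Meq char_poly_conj// char_poly_trig ?diag_mx_is_trig//.
  by apply: eq_bigr => j _; rewrite mxE eqxx mulr1n.
apply: (perm_map_inj (@complexI R)); rewrite -map_comp.
apply: prod_XsubC_eq; rewrite !big_map -charM charD -enumT big_enum/=.
by apply: eq_bigr => j _; rewrite /= De.
Qed.

(** On vectors with first coordinate 0, [H] is the standard inner product and
    the border contributes nothing to the form [H X], which is the form of the
    corner [M]; an orthonormal eigenbasis of [M] thus diagonalizes both. *)
Lemma bordered_diag (R : realType) (n : nat) (a : R) (b : 'cV[R[i]]_n)
    (M : 'M[R[i]]_n) (l : seq R) :
    M \is hermsymmx ->
    char_poly M = \prod_(r <- l) ('X - (r%:C)%:P) ->
  exists (B : 'M[R[i]]_(n, 1 + n)) (e : 'I_n -> R),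
    [/\ row_free B, B *m Hmx R n *m B ^t* = 1%:M,
        B *m (Hmx R n *m Xmx a b M) *m B ^t* = diag_mx (\row_j (e j)%:C) &
        perm_eq [seq e j | j <- enum 'I_n] l].
Proof.
move=> hM /(hermitian_diag hM)[V [e [VV VM pe]]].
pose B : 'M[R[i]]_(n, 1 + n) := row_mx 0 V.
have BS : B ^t* = col_mx 0 (V ^t*).
  by rewrite tr_row_mx map_col_mx trmx0 map_mx0.
exists B, e; split=> //.
- by apply/row_freeP; exists (B ^t*); rewrite BS mul_row_col mul0mx add0r.
- rewrite /Hmx mul_row_block !mul0mx !mulmx0 mulmx1 !add0r.
  by rewrite BS mul_row_col mul0mx add0r.
- rewrite /Hmx /Xmx mulmx_block !mul0mx !mul1mx !add0r mul_row_block !mul0mx.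
  by rewrite !add0r BS mul_row_col mulmx0 add0r.
Qed.

(** * Comparison of the counting functions *)

(** The last clause does not follow from the first two, because the lists may
    have different sizes; it controls the points at the right of an interval. *)
Definition close_counts (R : numDomainType) (c : nat) (zs ls : seq R) : Prop :=
  forall t, [/\ (count (fun z => (z <= t)%R) zs <=
                 count (fun l => (l <= t)%R) ls + c)%N,
                (count (fun l => (l <= t)%R) ls <=
                 count (fun z => (z <= t)%R) zs + c)%N &
                (count (fun z => (t < z)%R) zs <=
                 count (fun l => (t < l)%R) ls + c)%N].

Lemma count_le_gt (R : realDomainType) (t : R) (s : seq R) :
  (count (fun z => (z <= t)%R) s + count (fun z => (t < z)%R) s)%N = size s.
Proof.
rewrite -(count_predC (fun z => z <= t) s); congr addn.
by apply: eq_count => z /=; rewrite ltNge.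
Qed.

Lemma count_map_enum (A : Type) n (d : 'I_n -> A) (p : pred A) :
  count p [seq d j | j <- enum 'I_n] = #|[set j | p (d j)]%SET|.
Proof. by rewrite -sum1_count big_map big_enum_cond sum1dep_card. Qed.

Lemma pencil_diag (R : rcfType) n p (A : 'M[R[i]]_(p, n)) (H K : 'M[R[i]]_n)
    (d : 'I_p -> R) (t : R) :
  A *m H *m A ^t* = 1%:M -> A *m K *m A ^t* = diag_mx (\row_j (d j)%:C) ->
  A *m (K - t%:C *: H) *m A ^t* = diag_mx (\row_j (d j - t)%:C).
Proof.
move=> AH AK; rewrite mulmxBr mulmxBl AK -scalemxAr -scalemxAl AH.
by apply/matrixP => i j; rewrite !mxE rmorphB mulrnBl mulr_natr.
Qed.

Lemma pencil_count (R : rcfType) n p q (A : 'M[R[i]]_(p, n))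
    (B : 'M[R[i]]_(q, n)) (H K : 'M[R[i]]_n) (d : 'I_p -> R) (e : 'I_q -> R)
    (t : R) :
    row_free A -> row_free B ->
    A *m H *m A ^t* = 1%:M -> A *m K *m A ^t* = diag_mx (\row_j (d j)%:C) ->
    B *m H *m B ^t* = 1%:M -> B *m K *m B ^t* = diag_mx (\row_j (e j)%:C) ->
  (count (fun z => (t < z)%R) [seq d j | j <- enum 'I_p] +
   count (fun l => (l <= t)%R) [seq e j | j <- enum 'I_q] <= n)%N.
Proof.
move=> fA fB AH AK BH BK; rewrite !count_map_enum.
have := card_pos_neg_diag fA fB (pencil_diag t AH AK) (pencil_diag t BH BK).
apply: leq_trans; apply: leq_add; apply/eq_leq/eq_card => j;
  by rewrite !inE ?subr_gt0 ?subr_le0.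
Qed.

(** Two applications of [pencil_count], with the families exchanged.  Besides
    the loss of 1 from the dimension [n + 1], the first [k <= 3] dimensions
    carry no [zeta]. *)
Lemma canonical_close_counts (R : realType) (n k : nat) (a : R)
    (b : 'cV[R[i]]_n) (M : 'M[R[i]]_n) (zeta : nat -> R) (l : seq R) :
    M \is hermsymmx -> char_poly M = \prod_(r <- l) ('X - (r%:C)%:P) ->
    has_canonical_form (Xmx a b M) (Hmx R n) k zeta ->
  close_counts 3 [seq zeta (k + j)%N | j <- iota 0 (n.+1 - k)] l.
Proof.
move=> hM charM /canonical_form_diag[k3 [m [A [km fA AH AK]]]] t.
have [B [e [fB BH BK pe]]] := bordered_diag a b hM charM.
have -> : (n.+1 - k)%N = m by lia.
have zeq : [seq zeta (k + j)%N | j <- iota 0 m] =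
           [seq zeta (k + j)%N | j : 'I_m <- enum 'I_m].
  by rewrite -val_enum_ord -map_comp.
have := pencil_count t fA fB AH AK BH BK.
have := pencil_count t fB fA BH BK AH AK.
have := count_le_gt t l; have := count_le_gt t [seq zeta (k + j)%N | j <- iota 0 m].
rewrite size_map size_iota -zeq !(permP pe) -(perm_size pe) size_map size_enum_ord.
by do 4![move: (count _ _) => ?]; clear -km k3 => h1 h2 h3 h4; split; lia.
Qed.

(** * Comparison of sums of a continuous function *)

Definition sum_on (R : realDomainType) (f : R -> R) (a b : R) (s : seq R) : R :=
  \sum_(z <- s | a < z <= b) f z.

Definition count_on (R : realDomainType) (a b : R) (s : seq R) : nat :=
  count (fun z => a < z <= b) s.

Lemma count_on_le (R : realDomainType) (a b : R) (s : seq R) : a <= b ->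
  (count (fun z => (z <= a)%R) s + count_on a b s)%N =
  count (fun z => (z <= b)%R) s.
Proof.
move=> ab; elim: s => //= z s; rewrite /count_on /=.
by case: (leP z a) => za /= <-; first rewrite (le_trans za ab); lia.
Qed.

Lemma count_on_cat (R : realDomainType) (a b c : R) (s : seq R) :
  a <= b -> b <= c ->
  count_on a c s = (count_on a b s + count_on b c s)%N.
Proof.
move=> ab bc; have := count_on_le s ab; have := count_on_le s bc.
by have := count_on_le s (le_trans ab bc); lia.
Qed.

Lemma sum_on_cat (R : realDomainType) (f : R -> R) (a b c : R) (s : seq R) :
  a <= b -> b <= c -> sum_on f a c s = sum_on f a b s + sum_on f b c s.
Proof.
move=> ab bc; rewrite /sum_on (bigID (fun z => z <= b))/=; congr (_ + _).
  apply: eq_bigl => z; rewrite -andbA; congr andb.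
  by case: (leP z b) => zb; rewrite ?andbF// (le_trans zb bc).
apply: eq_bigl => z; rewrite -ltNge andbC andbA.
by case: (ltP b z) => bz //=; rewrite (le_lt_trans ab bz).
Qed.

Lemma count_on_close (R : realDomainType) (c : nat) (a b : R) (zs ls : seq R) :
  close_counts c zs ls -> a <= b ->
  (count_on a b zs <= count_on a b ls + 2 * c)%N /\
  (count_on a b ls <= count_on a b zs + 2 * c)%N.
Proof.
move=> close ab; have [a1 a2 _] := close a; have [b1 b2 _] := close b.
have := count_on_le zs ab; have := count_on_le ls ab.
by move: a1 a2 b1 b2; do 4 move: (count _ _) => ?; lia.
Qed.

Lemma sum_on_bound (R : realDomainType) (f : R -> R) (a b e : R) (s : seq R) :
  (forall z, a < z <= b -> `|f z| <= e) ->
  `|sum_on f a b s| <= e * (count_on a b s)%:R.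
Proof.
move=> fe; rewrite (le_trans (ler_norm_sum _ _ _))//.
rewrite (le_trans (ler_sum _ fe))// /count_on -sum1_count natr_sum mulr_sumr.
by apply: ler_sum => z _; rewrite mulr1.
Qed.

(** The constant [D] must not depend on the lists: it becomes negligible after
    division by their common order of size, whereas the first term is of that
    order but has a small factor.  In this form the property is additive in the
    interval. *)
Definition sums_close_on (R : realDomainType) (f : R -> R) (c : nat) (e a b : R)
    : Prop :=
  exists D, forall zs ls, close_counts c zs ls ->
    `|sum_on f a b zs - sum_on f a b ls| <=
    e * (count_on a b zs + count_on a b ls)%:R + D.

Lemma sums_close_on_cat (R : realDomainType) (f : R -> R) (c : nat)
    (e x y z : R) : x <= y -> y <= z ->
  sums_close_on f c e x y -> sums_close_on f c e y z ->
  sums_close_on f c e x z.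
Proof.
move=> xy yz [D hD] [D' hD']; exists (D + D') => zs ls close.
rewrite !(sum_on_cat f _ xy yz) !(count_on_cat _ xy yz) opprD addrACA.
rewrite (le_trans (ler_normD _ _))// (le_trans (lerD (hD _ _ close) (hD' _ _ close)))//.
by rewrite !natrD; lra.
Qed.

(** Replace [f] by the constant [f b]: this costs [e] for each point, and the
    sums of a constant differ by a multiple of the difference of the numbers of
    points, which is at most [2 c]. *)
Lemma sums_close_on_osc (R : realDomainType) (f : R -> R) (c : nat)
    (e a b : R) : a <= b -> (forall z, a < z <= b -> `|f z - f b| <= e) ->
  sums_close_on f c e a b.
Proof.
move=> ab fe; exists (`|f b| * (2 * c)%:R) => zs ls close.
have E s : sum_on f a b s = sum_on (fun z => f z - f b) a b s +
                            f b * (count_on a b s)%:R.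
  rewrite /sum_on /count_on sumrB -sum1_count natr_sum mulr_sumr.
  under [X in _ - _ + X]eq_bigr do rewrite mulr1.
  by rewrite subrK.
have h1 := sum_on_bound zs fe; have h2 := sum_on_bound ls fe.
have h3 : `|f b * ((count_on a b zs)%:R - (count_on a b ls)%:R)| <=
          `|f b| * (2 * c)%:R.
  rewrite normrM ler_wpM2l// ler_norml.
  have [k1 k2] := count_on_close close ab.
  by move: k1 k2; rewrite -!(ler_nat R) !natrD => k1 k2; apply/andP; split; lra.
rewrite (E zs) (E ls) natrD.
rewrite [X in `|X|](_ : _ = sum_on (fun z => f z - f b) a b zs -
   sum_on (fun z => f z - f b) a b ls +
   f b * ((count_on a b zs)%:R - (count_on a b ls)%:R)); last by ring.
rewrite (le_trans (ler_normD _ _))// lerD//.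
by rewrite (le_trans (ler_normB _ _))// mulrDr lerD.
Qed.

(** Compactness is used as a covering property with respect to the filter of
    small positive [d]. *)
Lemma uniform_continuity_segment (R : realType) (f : R -> R) (a b e : R) :
  continuous f -> 0 < e ->
  exists2 d, 0 < d & forall x y, a <= x <= b -> `|x - y| < d ->
    `|f x - f y| <= e.
Proof.
move=> cf e0.
have /compact_near_coveringP cover := @segment_compact R a b.
have := cover _ (0^'+) (fun d x => forall y, `|x - y| < d -> `|f x - f y| <= e) _.
case.
  move=> x _.
  have /cvgrPdist_le /(_ (e / 2)) := cf x.
  case; first by rewrite divr_gt0.
  move=> r /= r0 hr.
  exists (ball x (r / 2), [set d : R | d < r / 2]) => /=.
    split; first by apply: nbhsx_ballx; rewrite divr_gt0.
    by apply: nbhs_right_lt; rewrite divr_gt0.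
  move=> [z d] /= [xz dr] y zy.
  have h1 : `|f x - f z| <= e / 2 by apply: hr; rewrite /ball_/= (lt_le_trans xz)//; lra.
  have h2 : `|f x - f y| <= e / 2.
    apply: hr; rewrite /ball_/= -(subrKA z) (le_lt_trans (ler_normD _ _))//.
    rewrite /ball/= in xz; lra.
  rewrite -(subrKA (f x)) (le_trans (ler_normD _ _))// distrC; lra.
move=> d /= d0 hd; exists (d / 2); first by rewrite divr_gt0.
move=> x y xab; apply: hd => /=; rewrite ?in_itv//= ?divr_gt0//.
by rewrite sub0r normrN gtr0_norm ?divr_gt0//; lra.
Qed.

Lemma sums_close_on_continuous (R : realType) (f : R -> R) (c : nat)
    (e a b : R) : continuous f -> 0 < e -> a <= b -> sums_close_on f c e a b.
Proof.
move=> cf e0 ab; have [d d0 hd] := uniform_continuity_segment a b cf e0.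
(* Cut [a, b] into [n] equal pieces, shorter than the modulus [d]. *)
pose n := (Num.truncn ((b - a) / d)).+1.
have ltn : (b - a) / n%:R < d.
  rewrite ltr_pdivrMr// mulrC -ltr_pdivrMr//.
  by rewrite truncnS_gt.
pose x i := a + (b - a) / n%:R * i%:R.
have step0 : 0 <= (b - a) / n%:R by rewrite divr_ge0// subr_ge0.
have xS i : x i.+1 = x i + (b - a) / n%:R by rewrite /x -natr1; ring.
have ax i : a <= x i by rewrite lerDl mulr_ge0.
have xn : x n = b by rewrite /x divfK ?pnatr_eq0//; ring.
have xb i : (i <= n)%N -> x i <= b.
  by move=> le_in; rewrite -xn lerD2l ler_wpM2l// ler_nat.
suff : forall i, (i <= n)%N -> sums_close_on f c e a (x i).
  by move=> /(_ n (leqnn n)); rewrite xn.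
elim=> [_|i IH lt_in].
  apply: sums_close_on_osc => // z; rewrite /x mulr0 addr0.
  by move=> /andP[/lt_le_trans h /h]; rewrite ltxx.
have xxS : x i <= x i.+1 by rewrite xS lerDl.
apply: (sums_close_on_cat (ax i) xxS); first exact/IH/ltnW.
apply: sums_close_on_osc => // z /andP[xz zx].
apply: hd; first by rewrite (le_trans (ax i) (ltW xz)) (le_trans zx)// xb.
rewrite xS in zx *; rewrite ltr_norml; lra.
Qed.

Lemma count_outside (R : realDomainType) (K : R) (s : seq R) : 0 <= K ->
  count (fun z => ~~ (- K < z <= K)) s =
  (count (fun z => (z <= - K)%R) s + count (fun z => (K < z)%R) s)%N.
Proof.
move=> K0; elim: s => //= z s ->; rewrite negb_and -leNgt -ltNge.
case: (leP z (-K)) => zK /=; case: (ltP K z) => Kz; rewrite ?addnS //; try lia.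
by exfalso; lra.
Qed.

Lemma sum_outside_bound (R : realDomainType) (f : R -> R) (M K : R)
    (s : seq R) : (forall z, `|f z| <= M) ->
  `|\sum_(z <- s) f z - sum_on f (- K) K s| <=
  M * (count (fun z => ~~ (- K < z <= K)) s)%:R.
Proof.
move=> fM; rewrite (bigID (fun z => - K < z <= K))/= /sum_on [X in `|X|]addrC addKr.
rewrite (le_trans (ler_norm_sum _ _ _))//.
rewrite (le_trans (ler_sum _ (fun z _ => fM z)))//.
rewrite -sum1_count natr_sum mulr_sumr.
by apply: ler_sum => z _; rewrite mulr1.
Qed.

(** Only the points of [ls] outside of [-K, K] appear, although both lists may
    have some: by [close_counts], [zs] has at most [2 c] more of them. *)
Lemma sums_close (R : realType) (f : R -> R) (c : nat) (M K e : R) :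
  continuous f -> (forall z, `|f z| <= M) -> 0 <= K -> 0 < e ->
  exists D, forall zs ls, close_counts c zs ls ->
    `|\sum_(z <- zs) f z - \sum_(l <- ls) f l| <=
    e * (size ls)%:R + 2 * M * (count (fun z => ~~ (- K < z <= K)) ls)%:R + D.
Proof.
move=> cf fM K0 e0; have e20 : 0 < e / 2 by rewrite divr_gt0.
have KK : - K <= K by lra.
have [D hD] := sums_close_on_continuous c cf e20 KK.
have M0 : 0 <= M := le_trans (normr_ge0 _) (fM 0).
exists (e * c%:R + M * (2 * c)%:R + D) => zs ls close.
have := hD _ _ close.
have := sum_outside_bound K zs fM; have := sum_outside_bound K ls fM.
set oz := count _ zs; set ol := count _ ls.
have ozl : M * oz%:R <= M * (ol%:R + (2 * c)%:R).
  rewrite ler_wpM2l// -natrD ler_nat /oz /ol !count_outside//.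
  have [h1 _ _] := close (- K); have [_ _ h2] := close K.
  by move: h1 h2; do 4 move: (count _ _) => ?; lia.
have cl : (e / 2) * (count_on (-K) K zs + count_on (-K) K ls)%:R <=
          e * (size ls)%:R + e * c%:R.
  rewrite -mulrDr -mulrA ler_pM2l// -natrD mulrC ler_pdivrMr// -natrM ler_nat.
  have [h1 _] := count_on_close close KK.
  have : (count_on (- K) K ls <= size ls)%N by apply: count_size.
  by move: h1; do 2 move: (count_on _ _ _) => ?; lia.
move: (sum_on _ _ _ zs) (sum_on _ _ _ ls) => sz sl h1 h2 h3.
move: h1 h2 h3; rewrite !ler_norml => /andP[] ? ? /andP[] ? ? /andP[] ? ?.
by apply/andP; split; lra.
Qed.

(** * Integrals of point masses and tightness *)

(** The additivity of the integral in the measure is first obtained for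
    nonnegative functions; the general case below splits [f] into its positive
    and negative parts. *)
Lemma integral_point_masses_ge0 (R : realType) (N k : nat) (z : nat -> R)
    (h : R -> R) : measurable_fun [set: R] h -> (forall x, 0 <= h x) ->
  (\int[point_masses N k z]_x (h x)%:E =
   (N%:R^-1 * \sum_(y <- [seq z (k + j)%N | j <- iota 0 (N.+1 - k)]) h y)%:E)%E.
Proof.
move=> mh h0; have mhE : measurable_fun [set: R] (EFin \o h).
  exact/measurable_EFinP.
rewrite /point_masses ge0_integral_mscale//=; last by move=> x _; rewrite lee_fin.
rewrite ge0_integral_measure_sum//; last by move=> x _; rewrite lee_fin.
rewrite EFinM; congr (_ * _)%E.
rewrite -val_enum_ord big_map big_map big_enum -sumEFin.
by apply: eq_bigr => j _; rewrite integral_dirac// diracT mul1e.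
Qed.

Lemma Rintegral_point_masses (R : realType) (N k : nat) (z : nat -> R)
    (f : R -> R) : continuous f ->
  Rintegral (point_masses N k z) [set: R] f =
  N%:R^-1 * \sum_(y <- [seq z (k + j)%N | j <- iota 0 (N.+1 - k)]) f y.
Proof.
move=> /continuous_measurable_fun mf; rewrite /Rintegral integralE.
have -> : (fun x => (f x)%:E)^\+%E = EFin \o (fun x => Num.max (f x) 0).
  by apply/funext => x; rewrite funeposE/= EFin_max.
have -> : (fun x => (f x)%:E)^\-%E = EFin \o (fun x => Num.max (- f x) 0).
  by apply/funext => x; rewrite funenegE/= EFin_max.
rewrite !integral_point_masses_ge0//; last 4 first.
- by apply: measurable_maxr => //; exact: measurableT_comp.
- by move=> x; rewrite le_max lexx orbT.
- exact: measurable_maxr.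
- by move=> x; rewrite le_max lexx orbT.
rewrite -EFinB/= -mulrBr -sumrB; congr (_ * _).
apply: eq_bigr => y _; rewrite /Order.max; do 2 case: ltP => ?; lra.
Qed.

(** If [l] were not [r], the event that the distance to [l] is at least
    [`|l - r|] would have probability 1 for all [n > 0]. *)
Lemma cvg_in_proba_cst (d : measure_display) (T : measurableType d)
    (R : realType) (P : probability T R) (Y : nat -> T -> R) (r l : R) :
  (forall n, (0 < n)%N -> forall t, Y n t = r) -> cvg_in_proba P Y l -> l = r.
Proof.
move=> Yr cvgY; apply/eqP; rewrite -subr_eq0 -normr_eq0 eq_le normr_ge0 andbT.
rewrite leNgt; apply/negP => e0.
have cvg0 := cvgY _ e0.
have cvg1 : (P^*)%mu [set t | `|l - r| <= `|Y n t - l|] @[n --> \oo] --> 1%E.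
  apply: cvg_near_cst; exists 1%N => // n /= n0.
  have -> : [set t | `|l - r| <= `|Y n t - l|] = setT.
    by apply/seteqP; split=> // t _ /=; rewrite Yr// distrC.
  rewrite -[RHS](@probability_setT _ _ _ P).
  exact/measurable_mu_extE/measurableT.
have /eqP : (0 : \bar R)%E = 1%E by apply: cvg_unique cvg0 cvg1; exact: ereal_hausdorff.
by rewrite eq_sym onee_eq0.
Qed.

(** Test against the constant 1.  An infinite mass is excluded because its
    finite part would be 0. *)
Lemma weak_cvg_mass1 (d : measure_display) (T : measurableType d)
    (R : realType) (P : probability T R) (z : nat -> T -> nat -> R)
    (mu : {measure set R -> \bar R}) :
  weak_cvg_in_proba P (fun N t => point_masses N 1 (z N t)) mu ->
  mu [set: R] = 1%E.
Proof.
have c1 : continuous (cst 1 : R -> R) by move=> x; apply: cst_continuous.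
have b1 : bounded_fun (cst 1 : R -> R).
  by exists 1; split=> // M M1 x _ /=; rewrite normr1 ltW.
move=> /(_ (cst 1) c1 b1) /(@cvg_in_proba_cst _ _ _ _ _ 1) mass1.
have {mass1} : Rintegral mu [set: R] (cst 1) = 1.
  apply: mass1 => N N0 t; rewrite Rintegral_point_masses//.
  rewrite (eq_bigr (fun=> 1))// big_const_seq count_predT iter_addr addr0.
  by rewrite size_map size_iota subn1 mulVf// pnatr_eq0 -lt0n.
have -> : Rintegral mu [set: R] (cst 1) = fine (mu [set: R]).
  by rewrite -[RHS]mul1r; apply: Rintegral_cst.
by case: (mu setT) => [r /= -> //| |] /eqP; rewrite eq_sym oner_eq0.
Qed.

(** A continuous substitute for the indicator function of the complement of
    [-K, K]: it vanishes on [-K, K] and is 1 outside of [-(K + 1), K + 1]. *)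
Definition tail_cutoff (R : realType) (K : R) (x : R) : R :=
  Num.min 1 (Num.max 0 (`|x| - K)).

Lemma tail_cutoff_continuous (R : realType) (K : R) :
  continuous (tail_cutoff K).
Proof.
have -> : tail_cutoff K = cst 1 \min (cst 0 \max (fun y : R => `|y| - K)).
  by apply/funext.
move=> x; apply: continuous_min; first exact: cst_continuous.
apply: continuous_max; first exact: cst_continuous.
by apply: continuousB; [exact: norm_continuous | exact: cst_continuous].
Qed.

Lemma tail_cutoff_ge0 (R : realType) (K x : R) : 0 <= tail_cutoff K x.
Proof. by rewrite le_min ler01 le_max lexx. Qed.

Lemma tail_cutoff_le1 (R : realType) (K x : R) : tail_cutoff K x <= 1.
Proof. by rewrite ge_min lexx. Qed.

Lemma tail_cutoff_out (R : realType) (K x : R) :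
  ~~ (- (K + 1) < x <= K + 1) -> tail_cutoff K x = 1.
Proof.
rewrite negb_and -leNgt -ltNge => xK.
apply/min_idPl; rewrite le_max; apply/orP; right.
have := ler_norm x; have := ler_norm (- x); rewrite normrN.
case/orP: xK => ? ? ?; lra.
Qed.

(** The sets [n <= `|x|] decrease to the empty set, so that their measures tend
    to 0. *)
Lemma tail_cutoff_small (R : realType) (mu : {measure set R -> \bar R})
    (eta : R) : mu [set: R] = 1%E -> 0 < eta ->
  exists2 K, 0 <= K & Rintegral mu [set: R] (tail_cutoff K) <= eta.
Proof.
move=> mu1 eta0.
pose F (n : nat) : set R := [set x | n%:R <= `|x|].
have mF n : measurable (F n).
  rewrite [F n](_ : _ = [set: R] `&` Num.norm @^-1` `[n%:R, +oo[).
    by apply: normr_measurable => //.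
  by apply/seteqP; split=> x /=; rewrite in_itv/= andbT => //; case.
have muF n : (mu (F n) < +oo)%E.
  apply: (@le_lt_trans _ _ (mu [set: R])); last by rewrite mu1 ltry.
  by apply: le_measure; rewrite ?inE.
have F0 : \bigcap_n F n = set0.
  rewrite -subset0 => x /(_ (Num.truncn `|x|).+1 I).
  by rewrite /F/= leNgt truncnS_gt.
have : mu \o F @ \oo --> mu (\bigcap_n F n).
  apply: nonincreasing_cvg_mu => //.
  - by rewrite F0.
  - move=> m n mn; apply/subsetPset => x /=; apply: le_trans.
    by rewrite ler_nat.
rewrite F0 measure0 => /fine_cvgP[_] /cvgrPdist_le /(_ _ eta0)[n _ hn].
exists n%:R => //.
have := hn n (leqnn _); rewrite /= sub0r normrN => {}hn.
have muFfin : mu (F n) \is a fin_num.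
  by rewrite ge0_fin_numE.
apply: le_trans (le_trans (ler_norm _) hn).
have g_le : (\int[mu]_x (tail_cutoff n%:R x)%:E <= mu (F n))%E.
  rewrite -[X in (_ <= mu X)%E]setIT -integral_indic//.
  apply: ge0_le_integral => //.
  - by move=> x _; rewrite lee_fin tail_cutoff_ge0.
  - apply/measurable_EFinP; apply: continuous_measurable_fun.
    exact: tail_cutoff_continuous.
  - by apply/measurable_EFinP; exact: measurable_indic.
  move=> x _; rewrite lee_fin indicE; case: (boolP (x \in F n)) => xF.
    exact: tail_cutoff_le1.
  move: xF; rewrite notin_setE /= => /negP; rewrite -ltNge => xn.
  by rewrite /tail_cutoff (max_idPl _) ?(min_idPr _)//; lra.
apply: fine_le => //; rewrite ge0_fin_numE ?(le_lt_trans g_le) ?ltey_eq ?muFfin//.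
by apply: integral_ge0 => x _; rewrite lee_fin tail_cutoff_ge0.
Qed.

(** * Transfer of weak convergence in probability *)

(** For large [N], the event that the integral of [f] for [zeta] is off by [e]
    is contained in the union of two events for [lambda]: the integral of [f]
    is off by [e / 4], or that of the tail cutoff is off by [eta].  Inclusion
    and subadditivity suffice, so outer measures raise no measurability
    question about [zeta]. *)
Lemma weak_cvg_close_counts (d : measure_display) (T : measurableType d)
    (R : realType) (P : probability T R) (c : nat) (k : nat -> T -> nat)
    (zeta lambda : nat -> T -> nat -> R) (mu : {measure set R -> \bar R}) :
  (forall N, (0 < N)%N -> forall t, close_counts c
     [seq zeta N t (k N t + j)%N | j <- iota 0 (N.+1 - k N t)]
     [seq lambda N t (1 + j)%N | j <- iota 0 (N.+1 - 1)]) ->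
  weak_cvg_in_proba P (fun N t => point_masses N 1 (lambda N t)) mu ->
  weak_cvg_in_proba P (fun N t => point_masses N (k N t) (zeta N t)) mu.
Proof.
move=> close cvg_nu f cf bf e e0; have mu1 := weak_cvg_mass1 cvg_nu.
have [M M0 fM] : exists2 M, 0 < M & forall x, `|f x| <= M.
  have [B [_ hB]] := bf; exists (Num.max 1 (B + 1)).
    by rewrite lt_max ltr01.
  by move=> x; apply: hB => //; rewrite lt_max ltrDl ltr01 orbT.
(* With both deviations small, the total error is less than
   [e / 4] for [f], twice [e / 8] from [sums_close], and
   [2 * M * (2 * eta) = e / 4] from the tail. *)
pose eta := e / (16 * M); have eta0 : 0 < eta by rewrite divr_gt0// mulr_gt0.
have [K K0 gK] := tail_cutoff_small mu1 eta0.
set g := tail_cutoff K in gK.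
have cg : continuous g by apply: tail_cutoff_continuous.
have bg : bounded_fun g.
  exists 1; split=> // B B1 x _ /=.
  by rewrite ger0_norm ?tail_cutoff_ge0// (le_trans (tail_cutoff_le1 K x)) ?ltW.
have e40 : 0 < e / 4 by rewrite divr_gt0.
have e80 : 0 < e / 8 by rewrite divr_gt0.
have K10 : 0 <= K + 1 by rewrite addr_ge0.
have [D hD] := sums_close c cf fM K10 e80.
have cvg_f := cvg_nu f cf bf _ e40; have cvg_g := cvg_nu g cg bg _ eta0.
set A := (fun N => (P^*)%mu _) in cvg_f; set B := (fun N => (P^*)%mu _) in cvg_g.
apply: (@squeeze_cvge _ _ _ _ (cst 0%E) _ (fun N => A N + B N)%E); last 2 first.
- exact: cvg_cst.
- by rewrite -[X in _ --> X]adde0; apply: cvgeD.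
have D8 : 0 < `|D| + 1 by apply: ltr_wpDl.
(* [N] is so large that the constant [D] contributes at most [e / 8]. *)
exists (Num.truncn ((`|D| + 1) / (e / 8))).+1 => // N /= N_large.
apply/andP; split; first exact: outer_measure_ge0.
apply: le_trans (outer_measureU2 _ _ _).
apply: le_outer_measure => t /= far.
have N0 : (0 < N)%N by apply: leq_trans N_large.
have NR0 : 0 < N%:R :> R by rewrite ltr0n.
have DN : D / N%:R <= e / 8.
  rewrite ler_pdivrMr// mulrC -ler_pdivrMr//.
  rewrite (@le_trans _ _ ((`|D| + 1) / (e / 8)))//.
    by rewrite ler_pM2r ?invr_gt0//; have := ler_norm D; lra.
  by rewrite (le_trans (ltW (truncnS_gt _)))// ler_nat.
case: (leP (e / 4) `|Rintegral (point_masses N 1 (lambda N t)) setT f -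
                     Rintegral mu setT f|) => near_f; first by left.
right; rewrite leNgt; apply/negP => near_g; move: far; rewrite leNgt => /negP; apply.
move: near_f near_g; rewrite !Rintegral_point_masses//.
have := hD _ _ (close N N0 t).
set zs := map _ _; set ls := map _ _ => Hsum.
have szl : size ls = N by rewrite size_map size_iota subn1.
set nug := N%:R^-1 * \sum_(y <- ls) g y.
have out_g : (count (fun z => ~~ (- (K + 1) < z <= K + 1)) ls)%:R <= nug * N%:R.
  rewrite /nug mulrAC mulVf ?gt_eqF// mul1r -sum1_count natr_sum.
  rewrite [leRHS](bigID (fun z => ~~ (- (K + 1) < z <= K + 1)))/=.
  rewrite -[leLHS]addr0 lerD ?sumr_ge0// => [|y _]; last exact: tail_cutoff_ge0.
  by apply: ler_sum => y /tail_cutoff_out; rewrite /g => ->.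
rewrite szl in Hsum; move=> near_f near_g.
have {Hsum} : `|N%:R^-1 * \sum_(z <- zs) f z - N%:R^-1 * \sum_(l <- ls) f l| <=
    e / 8 + 2 * (M * nug) + e / 8.
  rewrite -mulrBr normrM gtr0_norm ?invr_gt0// mulrC ler_pdivrMr//.
  rewrite (le_trans Hsum)// [leRHS](_ : _ =
    e / 8 * N%:R + 2 * M * (nug * N%:R) + e / 8 * N%:R); last by ring.
  rewrite lerD//; last by rewrite -ler_pdivrMr.
  by rewrite lerD// ler_pM2l// mulr_gt0.
have : M * nug <= e / 8.
  have -> : e / 8 = M * (2 * eta) by rewrite /eta; field; rewrite gt_eqF.
  by rewrite ler_pM2l//; move: near_g; rewrite ltr_norml => /andP[]; lra.
move: near_f; rewrite ltr_norml => /andP[? ?] ?; rewrite ler_norml => /andP[? ?].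
by rewrite ltr_norml; apply/andP; split; lra.
Qed.

Theorem theorem7 (R : realType) (disp : measure_display)
    (T : measurableType disp) (P : probability T R)
    (a : nat -> {RV P >-> R})
    (b : forall N, T -> 'cV[R[i]]_N)
    (C : forall N, T -> 'M[R[i]]_N)
    (x : nat -> T -> R[i]) (s : R)
    (lambda : nat -> T -> nat -> R)
    (mu0 : {measure set R -> \bar R})
    (k : nat -> T -> nat) (zeta : nat -> T -> nat -> R)
    (s_ge0 : 0 <= s)
    (C_rv : forall N, (0 < N)%N ->
      forall i j, complex_rv (fun t => C N t i j))
    (C_herm : forall N, (0 < N)%N -> forall t, C N t \is hermsymmx)
    (* (R0) *)
    (a_indep : forall N, (0 < N)%N ->
      indep P (sigma_rv (a N))
              (sigma_join (sigma_entries (b N)) (sigma_entries (C N))))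
    (a_cvg : cvg_in_proba P a 0)
    (* (R1), x j standing for x_{j+1,0} *)
    (b_def : forall N, (0 < N)%N ->
      forall t, b N t = \col_(j < N) ((Num.sqrt N%:R)^-1%:C * x j t))
    (x_rv : forall j, complex_rv (x j))
    (x_indep : mutual_indep P (fun j => sigma_crv (fun _ : unit => x j)))
    (x_same_law : forall i j, same_law P (x i) (x j))
    (x_indep_C : forall N, (0 < N)%N ->
      indep P (sigma_crv x) (sigma_entries (C N)))
    (x_mean0 : forall j,
      ('E_P[fun t => complex.Re (x j t)] = 0 /\
       'E_P[fun t => complex.Im (x j t)] = 0)%E)
    (x_var : forall j,
      ('E_P[(fun t => ComplexField.Normc.normc (x j t) ^+ 2)%R] =
       (s ^+ 2)%R%:E)%E)
    (* (R2) *)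
    (lambda_sorted : forall N, (0 < N)%N -> forall t i j,
      (1 <= i)%N -> (i <= j)%N -> (j <= N)%N -> lambda N t i <= lambda N t j)
    (lambda_eig : forall N, (0 < N)%N -> forall t,
      char_poly (C N t) =
        \prod_(1 <= j < N.+1) ('X - ((lambda N t j)%:C)%:P))
    (nu_cvg : weak_cvg_in_proba P
      (fun N t => point_masses N 1 (lambda N t)) mu0)
    (x_cont : forall j, continuous_law P (x j))
    (zeta_canonical : forall N, (0 < N)%N -> forall t,
      has_canonical_form (Xmx (a N t) (b N t) (C N t)) (Hmx R N)
                     (k N t) (zeta N t)) :
  weak_cvg_in_proba P (fun N t => point_masses N (k N t) (zeta N t)) mu0.
Proof.
apply: weak_cvg_close_counts nu_cvg => N N0 t.
apply: canonical_close_counts (C_herm N N0 t) _ (zeta_canonical N N0 t).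
by rewrite (lambda_eig N N0 t) big_map subn1 /= big_add1 /= /index_iota subn0.
Qed.
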